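(* Let $\omega<-\lambda_0(\Omega)$ and $m\in\mathcal{I}(\omega)$. If $m\in\mathcal{N}_{\Omega,\omega}$, then the dual problem is equivalent to the original problem in the sense that $\mathcal{E}^\ast(m)=\mathcal{E}(m)$, where $$\mathcal{E}(m):=\min_{\phi\in X,\ \|\phi\|_{L^2}^2=m}E(\phi),\qquad \mathcal{E}^\ast(m):=\sup_{\omega'<-\lambda_0(\Omega)}\ \inf_{\phi\in X}\left[E(\phi)+\omega'\left(\|\phi\|_{L^2}^2-m\right)\right].$$
   Context: Let $d\ge 2$, let $1<p<\infty$ if $d=2$ and $1<p<\frac{d+2}{d-2}$ if $d\ge 3$. Let $V:\mathbb{R}^d\to\mathbb{R}$ satisfy $V\ge 0$ and $\lim_{|\mathbf{x}|\to\infty}V(\mathbf{x})=\infty$. Let $\Omega_{\max}:=\sup\{\gamma\ge 0:\lim_{|\mathbf{x}|\to\infty}(V(\mathbf{x})-\frac{\gamma^2}{2}(x_1^2+x_2^2))=\infty\}$, assume $\Omega_{\max}>0$, and fix $0<\Omega<\Omega_{\max}$. Let $L_z=i(x_2\partial_{x_1}-x_1\partial_{x_2})$. Let $X$ be the space of complex-valued $\phi\in H^1(\mathbb{R}^d)$ with $\int_{\mathbb{R}^d}V|\phi|^2\,d\mathbf{x}<\infty$, with norm $\|\phi\|_X^2=\int_{\mathbb{R}^d}\big(|\nabla\phi|^2+(1+V)|\phi|^2\big)d\mathbf{x}$. For $\phi\in X$ the quantity $\int_{\mathbb{R}^d}\overline{\phi}L_z\phi\,d\mathbf{x}$ is well defined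 and real. Define the energy $E(\phi)=\frac12\|\nabla\phi\|_{L^2}^2+\int_{\mathbb{R}^d}V|\phi|^2\,d\mathbf{x}+\frac{2}{p+1}\|\phi\|_{L^{p+1}}^{p+1}-\Omega\int_{\mathbb{R}^d}\overline{\phi}L_z\phi\,d\mathbf{x}$ and the action $S_{\Omega,\omega}(\phi)=E(\phi)+\omega\|\phi\|_{L^2}^2$. Let $\lambda_0(\Omega)=\inf_{0\ne\phi\in X}\frac{\int_{\mathbb{R}^d}(\frac12|\nabla\phi|^2+V|\phi|^2-\Omega\overline{\phi}L_z\phi)d\mathbf{x}}{\|\phi\|_{L^2}^2}$. For $\omega<-\lambda_0(\Omega)$, the set of action ground states is $\mathcal{A}_{\Omega,\omega}:=\arg\min_{\phi\in X}S_{\Omega,\omega}(\phi)$, which is known to be nonempty with $\min_X S_{\Omega,\omega}<0$. Put $\mathcal{N}_{\Omega,\omega}:=\{\|\phi\|_{L^2}^2:\phi\in\mathcal{A}_{\Omega,\omega}\}$, $m^\ast(\omega):=\sup\mathcal{N}_{\Omega,\omega}$, $m_\ast(\omega):=\inf\mathcal{N}_{\Omega,\omega}$ and $\mathcal{I}(\omega):=[m_\ast(\omega),m^\ast(\omega)]$. *)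

(* Defs.v *)
From HB Require Import structures.
From mathcomp Require Import all_boot all_order all_algebra.
From mathcomp Require Import complex.
From mathcomp Require Import all_classical all_reals all_analysis.

Set Implicit Arguments.
Unset Strict Implicit.
Unset Printing Implicit Defensive.

Import Order.TTheory GRing.Theory Num.Theory.
Import numFieldNormedType.Exports.

Local Open Scope classical_set_scope.
Local Open Scope ring_scope.
Local Open Scope complex_scope.

(* The Borel sigma-algebra of R^n, generated by the coordinates. *)
Definition measure_rV_display : measure_display. Proof. exact. Qed.

Section measurable_rV.
Context {R : realType}.
Variable n : nat.

Let coors : 'I_n -> 'rV[R]_n -> measurableTypeR R := fun i x => x ord0 i.

Let rV_set0 : g_sigma_preimage coors set0.
Proof. exact: sigma_algebra0. Qed.

Let rV_setC A : g_sigma_preimage coors A -> g_sigma_preimage coors (~` A).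
Proof. exact: sigma_algebraC. Qed.

Let rV_bigcup (F : _^nat) : (forall i, g_sigma_preimage coors (F i)) ->
  g_sigma_preimage coors (\bigcup_i (F i)).
Proof. exact: sigma_algebra_bigcup. Qed.

HB.instance Definition _ := @isMeasurable.Build measure_rV_display
  'rV[R]_n (g_sigma_preimage coors) rV_set0 rV_setC rV_bigcup.

End measurable_rV.

Lemma measurable_coord (R : realType) n (i : 'I_n) :
  measurable_fun setT (fun x : 'rV[R]_n => x ord0 i : measurableTypeR R).
Proof.
move=> _ Y mY; rewrite setTI; apply: sub_sigma_algebra => /=.
rewrite -bigcup_seq/=; exists i => /=; first by rewrite mem_index_enum.
by exists Y => //; rewrite setTI.
Qed.

Lemma measurable_fun_coordP d (T : measurableType d) (R : realType) n
    (f : T -> 'rV[R]_n) :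
  (forall i, measurable_fun setT (fun x => f x ord0 i : measurableTypeR R)) ->
  measurable_fun setT f.
Proof.
move=> mf; suff H : g_sigma_preimage
    (fun i x => f x ord0 i : measurableTypeR R) `<=` measurable.
  move=> _ A mA; rewrite setTI; apply: H.
  have := @g_sigma_preimage_comp _ (measurableTypeR R) n 'rV[R]_n
    (fun i x => x ord0 i) T f.
  by rewrite /comp => ->; exists A => //; rewrite setTI.
apply: smallest_sub; first exact: sigma_algebra_measurable.
case: n => [|n] in f mf *; first by rewrite big_ord0.
rewrite -bigcup_mkord_ord; apply: bigcup_sub => i Ii.
by move=> A [B mB <-]; exact: mf.
Qed.

Section lebesgue_rV.
Context {R : realType}.

Definition cons_rV n (p : measurableTypeR R * 'rV[R]_n) : 'rV[R]_n.+1 :=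
  \row_i if unlift ord0 i is Some j then p.2 ord0 j else p.1.

Definition uncons_rV n (x : 'rV[R]_n.+1) : measurableTypeR R * 'rV[R]_n :=
  (x ord0 ord0, \row_j x ord0 (lift ord0 j)).

Lemma cons_rVK n : cancel (@cons_rV n) (@uncons_rV n).
Proof.
move=> [x y]; rewrite /uncons_rV !mxE unlift_none /=; congr (_, _).
by apply/rowP => j; rewrite !mxE liftK.
Qed.

Lemma uncons_rVK n : cancel (@uncons_rV n) (@cons_rV n).
Proof.
move=> x; apply/rowP => i; rewrite mxE.
by case: unliftP => [j ->|->] //=; rewrite mxE.
Qed.

Lemma measurable_cons_rV n : measurable_fun setT (@cons_rV n).
Proof.
apply: measurable_fun_coordP => i; case: (unliftP ord0 i) => [j ->|->].
  rewrite (_ : (fun _ => _) = fun p : measurableTypeR R * 'rV[R]_n =>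
    (p.2 ord0 j : measurableTypeR R)); last first.
    by apply/funext => p; rewrite mxE liftK.
  apply: (@measurableT_comp _ _ _ _ _ _
    (fun y : 'rV[R]_n => y ord0 j : measurableTypeR R)) => //.
  exact: measurable_coord.
rewrite (_ : (fun _ => _) = fst) //.
by apply/funext => p; rewrite mxE unlift_none.
Qed.

Lemma measurable_uncons_rV n : measurable_fun setT (@uncons_rV n).
Proof.
apply: measurable_fun_pair; first exact: measurable_coord.
apply: measurable_fun_coordP => j.
rewrite (_ : (fun _ => _) = fun x : 'rV[R]_n.+1 =>
  (x ord0 (lift ord0 j) : measurableTypeR R)); last first.
  by apply/funext => x; rewrite mxE.
exact: measurable_coord.
Qed.

Section step.
Variables (n : nat) (mu : {sigma_finite_measure set 'rV[R]_n -> \bar R}).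

Definition lebesgue_rV_step : set 'rV[R]_n.+1 -> \bar R :=
  pushforward (lebesgue_measure \x mu)%E (@cons_rV n).

Let step0 : lebesgue_rV_step set0 = 0%E.
Proof. by rewrite /lebesgue_rV_step /pushforward preimage_set0 measure0. Qed.

Let mpre A : measurable A -> measurable (@cons_rV n @^-1` A).
Proof.
by move=> mA; rewrite -[X in measurable X]setTI; exact: measurable_cons_rV.
Qed.

Let step_ge0 A : (0 <= lebesgue_rV_step A)%E.
Proof. by rewrite /lebesgue_rV_step /pushforward; apply: integral_ge0. Qed.

Let step_sigma_additive : semi_sigma_additive lebesgue_rV_step.
Proof.
move=> F mF tF mUF; rewrite /lebesgue_rV_step /pushforward preimage_bigcup.
apply: measure_semi_sigma_additive.
- by move=> k; exact: mpre.
- apply/trivIsetP => /= i j _ _ ij; rewrite -preimage_setI.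
  by move/trivIsetP : tF => /(_ _ _ _ _ ij) ->//; rewrite preimage_set0.
- by rewrite -preimage_bigcup; exact: mpre.
Qed.

HB.instance Definition _ := isMeasure.Build _ _ _
  lebesgue_rV_step step0 step_ge0 step_sigma_additive.

Let step_sigma_finite : sigma_finite setT lebesgue_rV_step.
Proof.
have /sigma_finiteP[F [TF ndF Foo]] := sigma_finiteT (@lebesgue_measure R).
have /sigma_finiteP[G [TG ndG Goo]] := sigma_finiteT mu.
exists (fun k => @uncons_rV n @^-1` (F k `*` G k)).
  rewrite -preimage_bigcup -[LHS](@preimage_setT _ _ (@uncons_rV n)).
  congr (_ @^-1` _); rewrite -setXTT TF TG predeqE => -[x y]; split.
    move=> [/= [i _ Fix] [k _ Gky]]; exists (maxn i k) => //; split.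
    - by move: x Fix; exact/subsetPset/ndF/leq_maxl.
    - by move: y Gky; exact/subsetPset/ndG/leq_maxr.
  by move=> [i _ []/= ? ?]; split; exists i.
move=> k; have [mFk Fk] := Foo k; have [mGk Gk] := Goo k; split.
  rewrite -[X in measurable X]setTI; apply: measurable_uncons_rV => //.
  exact: measurableX.
rewrite /lebesgue_rV_step /pushforward (_ : _ @^-1` _ = F k `*` G k).
  by rewrite product_measure1E// lte_mul_pinfty// ge0_fin_numE.
rewrite -comp_preimage (_ : _ \o _ = id) ?preimage_id//.
by apply/funext; exact: cons_rVK.
Qed.

HB.instance Definition _ := Measure_isSigmaFinite.Build _ _ _
  lebesgue_rV_step step_sigma_finite.

End step.

Fixpoint lebesgue_rV (d : nat) :
    {sigma_finite_measure set 'rV[R]_d -> \bar R} :=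
  if d is n.+1 then lebesgue_rV_step (lebesgue_rV n) else \d_(0 : 'rV[R]_0).

End lebesgue_rV.

Lemma lebesgue_rV_box (R : realType) d (A : 'I_d -> set (measurableTypeR R)) :
  (forall i, measurable (A i)) ->
  lebesgue_rV d [set x : 'rV[R]_d | forall i, A i (x ord0 i)] =
  (\prod_(i < d) lebesgue_measure (A i))%E.
Proof.
elim: d A => [|d IH] A mA.
  by rewrite big_ord0 /= diracE mem_set// => -[].
rewrite big_ord_recl -IH//=.
set B := [set x : 'rV[R]_d | _].
have mB : measurable B.
  rewrite (_ : B = \bigcap_(i in [set: 'I_d])
      ((fun x : 'rV[R]_d => x ord0 i : measurableTypeR R) @^-1` A (lift ord0 i))).
    apply: fin_bigcap_measurable => [|i _]; first exact: finite_finset.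
    by rewrite -[X in measurable X]setTI; exact: measurable_coord.
  by apply/seteqP; split => x /= xB i; [move=> _|]; exact: xB.
rewrite -product_measure1E// /lebesgue_rV_step /pushforward.
congr (_ _); apply/seteqP; split => -[x y] /=.
  move=> h; split => [|i]; first by have := h ord0; rewrite mxE unlift_none.
  by have := h (lift ord0 i); rewrite mxE liftK.
case=> hx hy i; rewrite mxE; case: unliftP => [j ->|->] //=; exact: hy.
Qed.

Section sobolev.
Context {R : realType} {d : nat}.
Local Notation Rd := 'rV[R]_d.
Local Notation mu := (@lebesgue_rV R d).
Implicit Types (f g : Rd -> R[i]) (psi : Rd -> R).

Definition partial (i : 'I_d) psi : Rd -> R := 'D_(delta_mx ord0 i) psi.

Fixpoint iter_partial (s : seq 'I_d) psi : Rd -> R :=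
  if s is i :: s' then partial i (iter_partial s' psi) else psi.

Definition smooth psi : Prop := forall s : seq 'I_d,
  continuous (iter_partial s psi) /\
  forall i x, derivable (iter_partial s psi) x (delta_mx ord0 i).

Definition test_function psi : Prop :=
  smooth psi /\ compact (closure [set x | psi x != 0]).

Definition modulus (z : R[i]) : R := Normc.normc z.

Definition cintegral f : R[i] :=
  (\int[mu]_x complex.Re (f x)) +i* (\int[mu]_x complex.Im (f x)).

Definition cmeasurable f : Prop :=
  measurable_fun [set: Rd] (fun x => complex.Re (f x)) /\
  measurable_fun [set: Rd] (fun x => complex.Im (f x)).

Definition locally_integrable_c f : Prop := cmeasurable f /\
  forall K : set Rd, compact K -> (\int[mu]_(x in K) (modulus (f x))%:E < +oo)%E.

Definition square_integrable f : Prop := cmeasurable f /\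
  mu.-integrable [set: Rd] (fun x => (modulus (f x) ^+ 2)%:E).

Definition weak_partial (i : 'I_d) f g : Prop :=
  [/\ locally_integrable_c f, locally_integrable_c g &
    forall psi, test_function psi ->
      cintegral (fun x => f x * (partial i psi x)%:C) =
      - cintegral (fun x => g x * (psi x)%:C)].

Definition H1 f : Prop := square_integrable f /\
  forall i, exists2 g, square_integrable g & weak_partial i f g.

(* Weak derivatives are unique up to null sets, so integrals of expressions in
   [wpartial] do not depend on the representative chosen here. *)
Definition wpartial (i : 'I_d) f : Rd -> R[i] :=
  xget (fun=> 0) [set g | weak_partial i f g].

Definition grad_sq f (x : Rd) : R := \sum_(i < d) modulus (wpartial i f x) ^+ 2.

(* The squared L^2 norm. *)
Definition mass f : R := \int[mu]_x (modulus (f x) ^+ 2).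

Definition enorm (x : Rd) : R := Num.sqrt (\sum_(i < d) x ord0 i ^+ 2).

(* The filter of |x| -> oo, for the Euclidean norm. *)
Definition at_infty : set_system Rd :=
  filter_from [set: R] (fun M => [set x | M < enorm x]).

End sobolev.

Section rotating_nls.
Context {R : realType} {d : nat} (hd : (2 <= d)%N).
Local Notation Rd := 'rV[R]_d.
Local Notation mu := (@lebesgue_rV R d).
Variable V : Rd -> R.
Implicit Types phi : Rd -> R[i].

Definition axis1 : 'I_d := Ordinal (ltnW hd).
Definition axis2 : 'I_d := Ordinal hd.

Definition Omega_max : \bar R := ereal_sup
  [set gamma%:E | gamma in [set gamma : R | 0 <= gamma /\
    (V x - gamma ^+ 2 / 2 * (x ord0 axis1 ^+ 2 + x ord0 axis2 ^+ 2))
      @[x --> at_infty] --> +oo]].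

Definition Lz phi (x : Rd) : R[i] :=
  'i%C * ((x ord0 axis2)%:C * wpartial axis1 phi x -
          (x ord0 axis1)%:C * wpartial axis2 phi x).

(* Integrability, not just a finite integral: the library integral of a
   nonnegative non-measurable function is a junk value, and V itself is not
   assumed measurable. *)
Definition X : set (Rd -> R[i]) := [set phi | H1 phi /\
  mu.-integrable [set: Rd] (fun x => (V x * modulus (phi x) ^+ 2)%:E)].

Variable Omega : R.

(* On X the complex integral is real, so [Re] only changes the type. *)
Definition angular_momentum phi : R :=
  complex.Re (cintegral (fun x => conjc (phi x) * Lz phi x)).

Definition lin_density phi (x : Rd) : R[i] :=
  (2^-1 * grad_sq phi x + V x * modulus (phi x) ^+ 2)%:C
  - Omega%:C * (conjc (phi x) * Lz phi x).

Definition lambda0 : \bar R := ereal_inf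
  [set (complex.Re (cintegral (lin_density phi)) / mass phi)%:E
  | phi in [set phi | X phi /\ ~ {ae mu, forall x, phi x = 0}]].

Variable p : R.

Definition energy phi : R :=
  2^-1 * (\int[mu]_x grad_sq phi x)
  + \int[mu]_x (V x * modulus (phi x) ^+ 2)
  + 2 / (p + 1) * (\int[mu]_x (modulus (phi x) `^ (p + 1)))
  - Omega * angular_momentum phi.

Definition action (omega : R) phi : R := energy phi + omega * mass phi.

Definition action_ground_states (omega : R) : set (Rd -> R[i]) :=
  [set phi | X phi /\ forall psi, X psi -> action omega phi <= action omega psi].

Definition masses (omega : R) : set R := mass @` action_ground_states omega.

Definition mass_sup (omega : R) : \bar R :=
  ereal_sup [set m%:E | m in masses omega].

Definition mass_inf (omega : R) : \bar R :=
  ereal_inf [set m%:E | m in masses omega].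

Definition mass_interval (omega : R) : set R :=
  [set m | (mass_inf omega <= m%:E <= mass_sup omega)%E].

Definition mass_sphere (m : R) : set (Rd -> R[i]) :=
  [set phi | X phi /\ mass phi = m].

(* An infimum; that it is a minimum is [min_energy_attained]. *)
Definition min_energy (m : R) : \bar R :=
  ereal_inf [set (energy phi)%:E | phi in mass_sphere m].

Definition min_energy_attained (m : R) : Prop :=
  exists2 phi, mass_sphere m phi & (energy phi)%:E = min_energy m.

Definition dual_energy (m : R) : \bar R := ereal_sup
  [set ereal_inf [set (energy phi + omega * (mass phi - m))%:E | phi in X]
  | omega in [set omega : R | (omega%:E < - lambda0)%E]].

End rotating_nls.

(* Main.v *)
Require Import Defs.
From mathcomp Require Import all_boot all_order all_algebra.
From mathcomp Require Import complex.
From mathcomp Require Import all_classical all_reals all_analysis.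

Import Order.TTheory GRing.Theory Num.Theory.
Import numFieldNormedType.Exports.

Local Open Scope classical_set_scope.
Local Open Scope ring_scope.

(** The energy and the action differ by the Lagrange term [omega * mass], which
    is constant on a mass sphere.  Hence an action ground state [phi] of mass
    [m], being a global minimizer of the action, minimizes the energy among
    states of mass [m] ([action_ground_state_min_energy]): the minimum in the
    primal problem is attained at [phi].

    The dual value never exceeds the primal one, because the multiplier term
    [omega * (mass - m)] vanishes on the sphere ([weak_duality]).  Conversely
    the multiplier [omega] for which [phi] is a ground state closes the gap:
    the Lagrangian is the action shifted by the constant [omega * m], so [phi]
    minimizes it over the whole space, with value [energy phi]
    ([dual_energy_ge_ground_state]).  Geometrically, the ground
    state supplies the affine function [m' |-> energy phi - omega * (m' - m)],
    which lies below the minimal energy and touches it at [m]; such a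
    supporting line at [m] is what strong duality requires. *)

Section duality.
Context {R : realType} {d : nat} (hd : (2 <= d)%N).
Variables (V : 'rV[R]_d -> R) (Omega p : R).
Local Notation energy := (energy hd V Omega p).
Local Notation ground_states := (action_ground_states hd V Omega p).
Local Notation min_energy := (min_energy hd V Omega p).
Local Notation dual_energy := (dual_energy hd V Omega p).

(** At equal mass, two states have the same Lagrange term [omega * mass], so
    comparing their actions compares their energies. *)
Lemma action_ground_state_min_energy omega phi :
  ground_states omega phi -> (energy phi)%:E = min_energy (mass phi).
Proof.
move=> [Xphi phi_min]; apply/eqP; rewrite eq_le; apply/andP; split.
  apply: le_ereal_inf_tmp => _ [psi [Xpsi mpsi] <-]; rewrite lee_fin.
  by have := phi_min psi Xpsi; rewrite /action mpsi lerD2r.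
by apply: ereal_inf_lbound; exists phi.
Qed.

(** Restricting the inner infimum of the dual problem to the sphere of mass [m]
    can only raise it, and there the multiplier term is zero. *)
Lemma weak_duality m : (dual_energy m <= min_energy m)%E.
Proof.
apply: ge_ereal_sup => _ [omega _ <-].
apply: le_ereal_inf_tmp => _ [phi [Xphi mphi] <-].
by apply: ereal_inf_lbound; exists phi => //; rewrite mphi subrr mulr0 addr0.
Qed.

(** The multiplier [omega] is a competitor in the outer supremum, and its
    Lagrangian is the action up to a constant, hence minimal at [phi]. *)
Lemma dual_energy_ge_ground_state omega phi :
  (omega%:E < - lambda0 hd V Omega)%E -> ground_states omega phi ->
  ((energy phi)%:E <= dual_energy (mass phi))%E.
Proof.
move=> omega_lt [_ phi_min].
apply: (@le_trans _ _ (ereal_inf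
  [set (energy psi + omega * (mass psi - mass phi))%:E | psi in X V]));
    last by apply: ereal_sup_ubound; exists omega.
apply: le_ereal_inf_tmp => _ [psi Xpsi <-]; rewrite lee_fin.
by rewrite mulrBr addrA lerBrDr; exact: phi_min.
Qed.

End duality.

Theorem theorem4p3 (R : realType) (d : nat) (hd : (2 <= d)%N)
    (p : R) (hp1 : 1 < p)
    (hp : (3 <= d)%N -> p < (d%:R + 2) / (d%:R - 2))
    (V : 'rV[R]_d -> R) (V_ge0 : forall x, 0 <= V x)
    (V_infty : V x @[x --> at_infty] --> +oo)
    (hOmega_max : (0 < Omega_max hd V)%E)
    (Omega : R) (hOmega0 : 0 < Omega) (hOmega : (Omega%:E < Omega_max hd V)%E)
    (omega : R) (homega : (omega%:E < - lambda0 hd V Omega)%E)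
    (m : R) (hmI : mass_interval hd V Omega p omega m)
    (hmN : masses hd V Omega p omega m) :
  min_energy_attained hd V Omega p m /\
  dual_energy hd V Omega p m = min_energy hd V Omega p m.
Proof.
case: hmN => phi phi_ground <-.
have phi_min := action_ground_state_min_energy _ _ _ _ _ _ phi_ground.
split; first by exists phi => //; case: phi_ground.
apply/eqP; rewrite eq_le weak_duality -phi_min.
exact: dual_energy_ge_ground_state homega phi_ground.
Qed.
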